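(* Let $A$ be a commutative ring and let $M$ be an $A$-module. Let $x_1,\dots,x_n$ and $u_1,\dots,u_n$ be sequences of elements of $A$, generating ideals $J_x=(x_1,\dots,x_n)$ and $J_u=(u_1,\dots,u_n)$. Assume that the sequence $x_1,\dots,x_n$ is $M$-independent and that $(w_{ij})_{1\le i,j\le n}$ are elements of $A$ such that $x_i=\sum_{j} w_{ij}u_j$ for every $i$ (so that $J_x\subset J_u$). Then: (1) The sequence $u_1,\dots,u_n$ is $M$-independent. (2) If $\Delta$ denotes the determinant of the matrix $(w_{ij})$, then the following equalities of submodules of $M$ hold: \[ (J_xM:J_u)=(J_x+(\Delta))M,\qquad (J_xM:(J_x+(\Delta)))=J_uM. \] (3) If $M$ is nonzero and of finite type, and if $J_u$ is contained in the Jacobson radical of $A$, then $\Delta\notin J_x$.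
   Context: A sequence $x_1,\dots,x_n$ of elements of a commutative ring $A$ is called $M$-independent (for an $A$-module $M$) if for all $m_1,\dots,m_n\in M$, the relation $\sum_i x_im_i=0$ implies $m_i\in (x_1,\dots,x_n)M$ for every $i$. For a submodule $N\subset M$ and an ideal $I$ of $A$, $(N:I)$ denotes the submodule $\{m\in M\mid am\in N \text{ for all } a\in I\}$ of $M$. *)

(* Defs.v *)
From mathcomp Require Import all_boot all_algebra.
From mathcomp Require Import boolp classical_sets.

Set Implicit Arguments.
Unset Strict Implicit.
Unset Printing Implicit Defensive.

Import GRing.Theory.

Local Open Scope ring_scope.
Local Open Scope classical_set_scope.

(* Commutative rings are [comPzRingType], so the zero ring is allowed.        *)
(* Submodules and ideals are arbitrary (Prop-valued) sets, rather than        *)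
(* MathComp's boolean closed predicates.                                      *)

Section Submodules.
Variables (A : comPzRingType) (M : lmodType A).
Implicit Types (N S : set M) (I : set A).

Definition submodule N : Prop :=
  [/\ N 0, (forall m1 m2, N m1 -> N m2 -> N (m1 + m2))
    & (forall (a : A) m, N m -> N (a *: m))].

Definition gen_submodule S : set M := smallest submodule S.

Definition finite_type : Prop :=
  exists (k : nat) (g : 'I_k -> M), gen_submodule (range g) = setT.

(* The submodule I M: finite sums of products a *: m with a in I. *)
Definition ideal_smul I : set M :=
  gen_submodule [set m | exists a m', I a /\ m = a *: m'].

Definition colon N I : set M := [set m | forall a, I a -> N (a *: m)].

End Submodules.

Arguments ideal_smul {A} M I.
Arguments finite_type {A} M.

Section Ideals.
Variable A : comPzRingType.
Implicit Types I J : set A.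

(* [A^o] is A regarded as a module over itself. *)
Definition ideal I : Prop := @submodule A A^o I.

Definition ideal_gen (n : nat) (x : 'I_n -> A) : set A :=
  @gen_submodule A A^o (range x).

Definition principal (a : A) : set A := @gen_submodule A A^o [set a].

Definition ideal_add I J : set A :=
  [set c | exists a b, [/\ I a, J b & c = a + b]].

Definition maximal_ideal I : Prop :=
  [/\ ideal I, I <> setT
    & forall J, ideal J -> I `<=` J -> J = I \/ J = setT].

Definition jacobson_radical : set A :=
  [set a | forall I, maximal_ideal I -> I a].

End Ideals.

Definition independent (A : comPzRingType) (M : lmodType A) (n : nat)
    (x : 'I_n -> A) : Prop :=
  forall m : 'I_n -> M, \sum_i x i *: m i = 0 ->
  forall i, ideal_smul M (ideal_gen x) (m i).

Arguments independent {A} M {n} x.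
Arguments jacobson_radical A : clear implicits.

(* Main.v *)
(* Let [wedge u] and [contract w_i] be the exterior product by u and the      *)
(* contraction by the i-th row w_i of w on L = M (x) Lambda(A^n). Then        *)
(* contract w_i o wedge u + wedge u o contract w_i = x_i, the wedge squares   *)
(* to 0, and the composite T_n of all n contractions takes the top            *)
(* coefficient of f to Delta times it in degree 0. Independence of x passes   *)
(* to L.                                                                      *)
(* If u_j m is in J_x M for all j, put f_0 = m. Inductively, wedge u f_k is   *)
(* some sum_i x_i h_i, and f_(k+1) = h_k again has wedge u h_k in J_x L by    *)
(* independence, since wedge u o wedge u = 0. Commuting the contractions with *)
(* the wedge, the degree 0 coefficient of T_k f_k is +- m modulo J_x M; for   *)
(* k = n this gives m in Delta M + J_x M.                                     *)
(* If Delta m is in J_x M, start from the top form g with coefficient m:      *)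
(* T_n g is in J_x L + u /\ L, and wedging with u and comparing the           *)
(* coefficients of x_k shows inductively, for k = n - 1, .., 0, that T_k g is *)
(* in J_x L + u /\ L. The top coefficient of g is then in J_u M.              *)
(* Finally sum_j u_j m_j = 0 gives, by the adjugate of w, Delta m_j in J_x M, *)
(* whence (1), and (3) is Nakayama's lemma applied to J_u M = M.              *)

From HB Require Import structures.
Require Import Defs.
From mathcomp Require Import all_boot all_algebra.
From mathcomp Require Import boolp classical_sets.

Set Implicit Arguments.
Unset Strict Implicit.
Unset Printing Implicit Defensive.

Import GRing.Theory.

Local Open Scope ring_scope.
Local Open Scope classical_set_scope.

(** * Submodules and products I M *)

(** By Cartan's formula [contract_wedge], contraction by row i of [w] makes multiplication by x_i
    null-homotopic for the differential [wedge u] on [exterior M n], and contracting by all rows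
    extracts [\det w] ([contractions_all]). Independence of x replaces exactness: in a relation
    sum_i x_i h_i = 0 every coefficient vanishes modulo J_x. Adding rows one at a time relates a
    degree 0 coefficient to a top one ([low_contractions_lift], hence [colon_gen_det]); removing
    them goes the other way ([wedge_mem_preimage], hence [det_colon_gen]). These give the two hard
    inclusions of (2); the other two reduce to Delta J_u being contained in J_x, which is Cramer's
    rule ([adj_mul_gen]). Cramer's rule with [det_colon_gen] also gives (1), and the second equality
    of (2) with [nakayama] gives (3). *)

Section SubmoduleFacts.
Variables (A : comPzRingType) (M : lmodType A).
Implicit Types (N S : set M) (I : set A) (m : M).

Lemma gen_submodule_submodule S : submodule (gen_submodule S).
Proof.
split=> [N [] [] //|m1 m2 N1 N2 N HN|a m N1 N HN].
  by case: (HN.1) => _ HD _; apply: HD; [exact: N1|exact: N2].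
by case: (HN.1) => _ _ HZ; apply: HZ; exact: N1.
Qed.

Lemma submodule_sum N (T : Type) (r : seq T) (F : T -> M) :
  submodule N -> (forall i, N (F i)) -> N (\sum_(i <- r) F i).
Proof. by case=> N0 ND _ NF; elim/big_ind: _. Qed.

Lemma ideal_smul_submodule I : submodule (ideal_smul M I).
Proof. exact: gen_submodule_submodule. Qed.

Lemma ideal_smul0 I : ideal_smul M I 0.
Proof. by case: (ideal_smul_submodule I). Qed.

Lemma ideal_smulD I m1 m2 :
  ideal_smul M I m1 -> ideal_smul M I m2 -> ideal_smul M I (m1 + m2).
Proof. by case: (ideal_smul_submodule I) => _ + _; apply. Qed.

Lemma ideal_smulZ I a m : ideal_smul M I m -> ideal_smul M I (a *: m).
Proof. by case: (ideal_smul_submodule I) => _ _; apply. Qed.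

Lemma ideal_smulN I m : ideal_smul M I m -> ideal_smul M I (- m).
Proof. by rewrite -scaleN1r; exact: ideal_smulZ. Qed.

Lemma ideal_smulB I m1 m2 :
  ideal_smul M I m1 -> ideal_smul M I m2 -> ideal_smul M I (m1 - m2).
Proof. by move=> J1 J2; apply: ideal_smulD => //; exact: ideal_smulN. Qed.

Lemma ideal_smul_sum I (T : Type) (r : seq T) (F : T -> M) :
  (forall i, ideal_smul M I (F i)) -> ideal_smul M I (\sum_(i <- r) F i).
Proof. exact: submodule_sum _ (ideal_smul_submodule I). Qed.

Lemma mem_ideal_smul I a m : I a -> ideal_smul M I (a *: m).
Proof. by move=> Ia; apply: sub_gen_smallest; exists a, m. Qed.

Lemma ideal_smul_sub I N : submodule N ->
  (forall a m, I a -> N (a *: m)) -> ideal_smul M I `<=` N.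
Proof.
by move=> subN IN; apply: smallest_sub => // m [a [m' [Ia ->]]]; exact: IN.
Qed.

Lemma gen_submodule_rangeP k (g : 'I_k -> M) m :
  gen_submodule (range g) m <-> exists c, m = \sum_i c i *: g i.
Proof.
split=> [|[c ->]]; last first.
  apply: (submodule_sum _ (gen_submodule_submodule (range g))) => i.
  case: (gen_submodule_submodule (range g)) => _ _; apply.
  by apply: sub_gen_smallest; exists i.
move: m; apply: smallest_sub => [|_ [i _ <-]]; last first.
  exists (fun j => (j == i)%:R); rewrite (bigD1 i) //= eqxx scale1r.
  by rewrite big1 ?addr0 // => j /negPf->; rewrite scale0r.
split=> [|_ _ [c ->] [d ->]|a _ [c ->]].
- by exists (fun=> 0); rewrite big1 // => i _; rewrite scale0r.
- exists (fun i => c i + d i); rewrite -big_split.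
  by under [RHS]eq_bigr do rewrite scalerDl.
- exists (fun i => a * c i); rewrite scaler_sumr.
  by under [RHS]eq_bigr do rewrite -scalerA.
Qed.
End SubmoduleFacts.

Lemma mem_ideal_gen (A : comPzRingType) n (x : 'I_n -> A) i : ideal_gen x (x i).
Proof. by apply: sub_gen_smallest; exists i. Qed.

Lemma ideal_genP (A : comPzRingType) n (x : 'I_n -> A) a :
  ideal_gen x a <-> exists c, a = \sum_i c i * x i.
Proof. exact: (@gen_submodule_rangeP A A^o). Qed.

(** This turns membership in J_x M into coefficients h_i, which independence can then compare. *)
Lemma ideal_smul_genP (A : comPzRingType) (M : lmodType A) n (x : 'I_n -> A)
    (m : M) :
  ideal_smul M (ideal_gen x) m <-> exists h, m = \sum_i x i *: h i.
Proof.
split=> [|[h ->]]; last first.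
  by apply: ideal_smul_sum => i; apply: mem_ideal_smul; exact: mem_ideal_gen.
move: m; apply: ideal_smul_sub => [|a m /ideal_genP[c ->]]; last first.
  exists (fun i => c i *: m); rewrite scaler_suml; apply: eq_bigr => i _.
  by rewrite scalerA mulrC.
split=> [|_ _ [c ->] [d ->]|a _ [c ->]].
- by exists (fun=> 0); rewrite big1 // => i _; rewrite scaler0.
- exists (fun i => c i + d i); rewrite -big_split.
  by under [RHS]eq_bigr do rewrite scalerDr.
- exists (fun i => a *: c i); rewrite scaler_sumr; apply: eq_bigr => i _.
  by rewrite !scalerA mulrC.
Qed.

Lemma ideal_smul_linear (A : comPzRingType) (V W : lmodType A) (f : V -> W) I v :
  linear f -> ideal_smul V I v -> ideal_smul W I (f v).
Proof.
move=> lin_f; have f0 : f 0 = 0.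
  by have := lin_f (-1) 0 0; rewrite scaler0 addr0 scaleN1r addNr.
have fZ a m : f (a *: m) = a *: f m.
  by have := lin_f a m 0; rewrite f0 !addr0.
move: v; apply: (ideal_smul_sub (N := f @^-1` ideal_smul W I))
    => [|a m Ia]; last first.
  by rewrite /= fZ; exact: mem_ideal_smul.
split=> [|m1 m2 J1 J2|a m Jm]; first by rewrite /= f0; exact: ideal_smul0.
  by rewrite /= -[m1]scale1r lin_f scale1r; exact: ideal_smulD.
by rewrite /= fZ; exact: ideal_smulZ.
Qed.

Lemma ideal_smul_pair (A : comPzRingType) (V W : lmodType A) I (v : V) (w : W) :
  ideal_smul V I v -> ideal_smul W I w -> ideal_smul (V * W)%type I (v, w).
Proof.
move=> Jv Jw; have -> : (v, w) = (v, 0) + (0, w) :> V * W.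
  by congr pair; rewrite /= ?addr0 ?add0r.
apply: ideal_smulD.
- apply: (@ideal_smul_linear _ _ _ (fun v => (v, 0))) Jv => a v1 v2.
  by congr pair; rewrite /= scaler0 addr0.
- apply: (@ideal_smul_linear _ _ _ (fun w => (0, w))) Jw => a w1 w2.
  by congr pair; rewrite /= scaler0 addr0.
Qed.

Lemma independent_pair (A : comPzRingType) (V W : lmodType A) n (x : 'I_n -> A) :
  independent V x -> independent W x -> independent (V * W)%type x.
Proof.
move=> indV indW m /= m0 i; rewrite [m i]surjective_pairing.
apply: ideal_smul_pair.
- apply: indV (fun i => (m i).1) _ i; rewrite -[RHS](congr1 fst m0).
  by symmetry; apply: (big_morph fst).
- apply: indW (fun i => (m i).2) _ i; rewrite -[RHS](congr1 snd m0).
  by symmetry; apply: (big_morph snd).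
Qed.

(** * Nakayama's lemma *)

Section Nakayama.
Variable A : comPzRingType.

Lemma ideal_setT (J : set A) : ideal J -> J 1 -> J = setT.
Proof.
case=> _ _ JZ J1; apply/seteqP; split=> // a _.
by rewrite -[a]mulr1; exact: JZ.
Qed.

Lemma proper_ideal_sub_maximal (I : set A) :
  ideal I -> ~ I 1 -> exists2 J, maximal_ideal J & I `<=` J.
Proof.
move=> idI I1.
(* The guard [J !=set0] accommodates the union of the empty chain. *)
pose P (J : set A) := J !=set0 -> [/\ ideal J, ~ J 1 & I `<=` J].
have [F FP totF|J [PJ maxJ]] := @Zorn_bigcup A P.
  case=> a [X FX Xa].
  have FE Y b : F Y -> Y b -> [/\ ideal Y, ~ Y 1 & I `<=` Y].
    by move=> FY Yb; apply: FP => //; exists b.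
  have [[X0 _ _] _ IX] := FE _ _ FX Xa.
  split; last by move=> b /IX; exists X.
    split; first by exists X.
      move=> b c [Y FY Yb] [Z FZ Zc].
      have [[_ YD _] _ _] := FE _ _ FY Yb.
      have [[_ ZD _] _ _] := FE _ _ FZ Zc.
      case: (totF _ _ FY FZ) => [YZ|ZY].
        by exists Z => //; apply: ZD => //; exact: YZ.
      by exists Y => //; apply: YD => //; exact: ZY.
    move=> b c [Y FY Yc]; exists Y => //.
    by have [[_ _ +] _ _] := FE _ _ FY Yc; apply.
  by case=> Y FY Y1; have [_ + _] := FE _ _ FY Y1; apply.
(* The empty set satisfies [P] vacuously, but it is not maximal: [I] contains 0 and satisfies
   [P]. *)
have J0 : J !=set0.
  apply: contrapT => J0; apply: (maxJ I); last by move=> _; split.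
  split=> [a Ja|IJ]; first by case: J0; exists a.
  by case: J0; exists 0; apply: IJ; case: idI.
have [idJ J1 IJ] := PJ J0; exists J => //; split=> // [JT|K idK JK].
  by apply: J1; rewrite JT.
have [K1|K1] := pselect (K 1); first by right; exact: ideal_setT.
left; apply/seteqP; split=> //; apply: contrapT => KJ.
apply: (maxJ K) => [|_]; first by split.
by split=> // a /IJ/JK.
Qed.

(** Otherwise the ideal generated by 1 - a is proper, hence lies in a maximal ideal; that ideal also
    contains a, so it contains 1. *)
Lemma jacobson_invertible (a : A) :
  jacobson_radical A a -> exists b, b * (1 - a) = 1.
Proof.
move=> rad_a; pose I : set A := [set b * (1 - a) | b in setT].
have idI : ideal I.
  split=> [|_ _ [b _ <-] [c _ <-]|b _ [c _ <-]].
  - by exists 0 => //; rewrite mul0r.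
  - by exists (b + c) => //; rewrite mulrDl.
  - by exists (b * c) => //; rewrite -mulrA.
apply: contrapT => no_inv.
have [|J maxJ IJ] := proper_ideal_sub_maximal idI.
  by case=> b _ b1; apply: no_inv; exists b.
have [idJ JT _] := maxJ; apply: JT; apply: ideal_setT => //.
rewrite -(subrK a 1); case: idJ => _ + _; apply; last exact: rad_a.
by apply: IJ; exists 1 => //; rewrite mul1r.
Qed.

Lemma ideal_smul_generated (M : lmodType A) (I : set A) k (g : 'I_k -> M) m :
  ideal I -> gen_submodule (range g) = setT -> ideal_smul M I m ->
  exists2 c, (forall i, I (c i)) & m = \sum_i c i *: g i.
Proof.
move=> [I0 ID IZ] genM; move: m; apply: ideal_smul_sub; last first.
  move=> a m Ia; have /gen_submodule_rangeP[c ->] : gen_submodule (range g) m.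
    by rewrite genM.
  exists (fun i => c i * a) => [i|]; first exact: IZ.
  by rewrite scaler_sumr; apply: eq_bigr => i _; rewrite scalerA mulrC.
split=> [|_ _ [c Ic ->] [d Id ->]|a _ [c Ic ->]].
- by exists (fun=> 0) => //; rewrite big1 // => i _; rewrite scale0r.
- exists (fun i => c i + d i) => [i|]; first exact: ID.
  rewrite -big_split.
  by under [RHS]eq_bigr do rewrite scalerDl.
- exists (fun i => a * c i) => [i|]; first exact: IZ.
  rewrite scaler_sumr.
  by under [RHS]eq_bigr do rewrite -scalerA.
Qed.

(** Induction on the number of generators: writing the first one with coefficients in I and
    inverting 1 - c_0 expresses it through the others. *)
Lemma nakayama (M : lmodType A) (I : set A) :
  ideal I -> I `<=` jacobson_radical A -> finite_type M ->
  ideal_smul M I = setT -> forall m : M, m = 0.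
Proof.
move=> idI radI [k [g genM]] IM.
elim: k g genM => [|k IHk] g genM.
  move=> m; have /gen_submodule_rangeP[c ->] : gen_submodule (range g) m.
    by rewrite genM.
  by rewrite big_ord0.
apply: (IHk (fun i => g (lift ord0 i))); apply/seteqP; split=> // m _.
have /(ideal_smul_generated idI genM)[c Ic g0] : ideal_smul M I (g ord0).
  by rewrite IM.
have [b b1] := jacobson_invertible (radI _ (Ic ord0)).
rewrite big_ord_recl in g0.
have {}g0 : g ord0 = \sum_i (b * c (lift ord0 i)) *: g (lift ord0 i).
  rewrite -[LHS]scale1r -b1 -scalerA scalerBl scale1r {1}g0 addrC addKr.
  by rewrite scaler_sumr; apply: eq_bigr => i _; rewrite scalerA.
have /gen_submodule_rangeP[d ->] : gen_submodule (range g) m by rewrite genM.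
apply/gen_submodule_rangeP.
exists (fun i => d ord0 * (b * c (lift ord0 i)) + d (lift ord0 i)).
rewrite big_ord_recl {1}g0 scaler_sumr -big_split; apply: eq_bigr => i _ /=.
by rewrite scalerA scalerDl.
Qed.
End Nakayama.
(** * Exterior algebra *)

Section Exterior.
Variables (A : comPzRingType) (M : lmodType A).

(* [exterior n] is M (x) Lambda(A^n), built one basis vector at a time: the   *)
(* pair [(p, q)] stands for p + e_0 /\ q, where p and q do not involve e_0.   *)
Fixpoint exterior n : lmodType A :=
  if n is k.+1 then (exterior k * exterior k)%type else M.

(** The minus sign comes from moving the remaining part of u past e_0; the one in [contract] has the
    same origin. *)
Fixpoint wedge n : ('I_n -> A) -> exterior n -> exterior n :=
  if n is k.+1 return ('I_n -> A) -> exterior n -> exterior n then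
    fun u f => (wedge (fun j => u (lift ord0 j)) f.1,
                u ord0 *: f.1 - wedge (fun j => u (lift ord0 j)) f.2)
  else fun _ _ => 0.

Fixpoint contract n : ('I_n -> A) -> exterior n -> exterior n :=
  if n is k.+1 return ('I_n -> A) -> exterior n -> exterior n then
    fun w f => (contract (fun j => w (lift ord0 j)) f.1 + w ord0 *: f.2,
                - contract (fun j => w (lift ord0 j)) f.2)
  else fun _ _ => 0.

(** [low] and [high] read the coefficients of 1 and of e_0 /\ ... /\ e_(n-1); [of_low] and [of_high]
    insert an element of M there. *)
Fixpoint low n : exterior n -> M :=
  if n is k.+1 return exterior n -> M then fun f => low f.1 else id.
Fixpoint high n : exterior n -> M :=
  if n is k.+1 return exterior n -> M then fun f => high f.2 else id.
Fixpoint of_low n : M -> exterior n :=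
  if n is k.+1 return M -> exterior n then fun m => (of_low k m, 0) else id.
Fixpoint of_high n : M -> exterior n :=
  if n is k.+1 return M -> exterior n then fun m => (0, of_high k m) else id.

Lemma wedge_is_linear n (u : 'I_n -> A) : linear (wedge u).
Proof.
elim: n u => [|n IHn] u a f g /=; first by rewrite scaler0 addr0.
congr pair; rewrite ?IHn //= scalerDr scalerA mulrC -scalerA.
by rewrite scalerBr opprD addrACA.
Qed.
HB.instance Definition _ n u := GRing.isLinear.Build A (exterior n) (exterior n)
  _ (@wedge n u) (wedge_is_linear u).

Lemma contract_is_linear n (w : 'I_n -> A) : linear (contract w).
Proof.
elim: n w => [|n IHn] w a f g /=; first by rewrite scaler0 addr0.
congr pair; rewrite ?IHn /=; last by rewrite opprD scalerN.
by rewrite !scalerDr !scalerA mulrC addrACA.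
Qed.
HB.instance Definition _ n w := GRing.isLinear.Build A (exterior n) (exterior n)
  _ (@contract n w) (contract_is_linear w).

Lemma low_is_linear n : linear (@low n).
Proof. by elim: n => [|n IHn] a f g //=; rewrite IHn. Qed.
HB.instance Definition _ n := GRing.isLinear.Build A (exterior n) M
  _ (@low n) (@low_is_linear n).

Lemma high_is_linear n : linear (@high n).
Proof. by elim: n => [|n IHn] a f g //=; rewrite IHn. Qed.
HB.instance Definition _ n := GRing.isLinear.Build A (exterior n) M
  _ (@high n) (@high_is_linear n).

Lemma of_low_is_linear n : linear (@of_low n).
Proof.
elim: n => [|n IHn] a f g //=; rewrite IHn; congr pair.
by rewrite /= scaler0 addr0.
Qed.
HB.instance Definition _ n := GRing.isLinear.Build A M (exterior n)
  _ (@of_low n) (@of_low_is_linear n).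

Lemma low_of_low n m : low (of_low n m) = m.
Proof. by elim: n. Qed.

Lemma high_of_high n m : high (of_high n m) = m.
Proof. by elim: n. Qed.

Lemma low_wedge n (u : 'I_n -> A) f : low (wedge u f) = 0.
Proof. by elim: n u f => [|n IHn] u f /=. Qed.

Lemma wedge_of_high n (u : 'I_n -> A) m : wedge u (of_high n m) = 0.
Proof.
elim: n u => [|n IHn] u //=.
by rewrite IHn linear0 scaler0 subr0.
Qed.

Lemma wedge_wedge n (u : 'I_n -> A) f : wedge u (wedge u f) = 0.
Proof.
elim: n u f => [|n IHn] u f //=; congr pair; rewrite ?IHn //.
by rewrite linearB linearZ /= IHn subr0 subrr.
Qed.

(** Cartan's formula: contraction is an antiderivation. When w is the i-th row of the transition
    matrix, the scalar is x_i. *)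
Lemma contract_wedge n (u w : 'I_n -> A) f :
  contract w (wedge u f) + wedge u (contract w f) = (\sum_j w j * u j) *: f.
Proof.
elim: n u w f => [|n IHn] u w f /=; first by rewrite big_ord0 addr0 scale0r.
rewrite big_ord_recl scalerDl; case: f => p q /=.
rewrite -/exterior in p q *.
set w' := fun j => w _; set u' := fun j => u _; congr pair => /=.
- rewrite -IHn (linearD (wedge u')) (linearZ_LR (wedge u')) /=.
  rewrite scalerBr scalerA [RHS]addrC -!addrA; congr (_ + _).
  by rewrite [X in _ + X]addrC addrAC subrK addrC.
- rewrite -IHn (linearB (contract w')) (linearZ_LR (contract w')).
  rewrite (linearN (wedge u')) /= scalerDr scalerA (mulrC (u _)).
  by rewrite opprB opprK -!addrA addKr addrCA.
Qed.

Definition contractions k n (W : 'I_k -> 'I_n -> A) (s : seq 'I_k) f :=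
  foldl (fun g i => contract (W i) g) f s.

Lemma contractions_enum0 n (W : 'I_0 -> 'I_n -> A) f :
  contractions W (enum 'I_0) f = f.
Proof. by rewrite enum_ord0. Qed.

Lemma contractions_enumS k n (W : 'I_k.+1 -> 'I_n -> A) f :
  contractions W (enum 'I_k.+1) f =
  contractions (fun i => W (lift ord0 i)) (enum 'I_k) (contract (W ord0) f).
Proof.
rewrite /contractions enum_ordSl /=.
elim: (enum _) (contract _ _) => //= i s IHs g.
Qed.


Lemma contractions_is_linear k n (W : 'I_k -> 'I_n -> A) s :
  linear (contractions W s).
Proof. by elim: s => //= i s IHs a f g; rewrite -IHs -contract_is_linear. Qed.
HB.instance Definition _ k n W s := GRing.isLinear.Build A (exterior n)
  (exterior n) _ (@contractions k n W s) (@contractions_is_linear k n W s).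

(** On e_0 /\ q, either some row i removes e_0, with sign (-1)^i from the earlier rows, and the
    other rows contract q, or e_0 survives all k rows. This is the shape of a Laplace expansion
    along column 0. *)
Lemma contractions_pair k n (W : 'I_k -> 'I_n.+1 -> A) (p q : exterior n) :
  let W' i j := W i (lift ord0 j) in
  contractions W (enum 'I_k) ((p, q) : exterior n.+1) =
  (contractions W' (enum 'I_k) p + \sum_(i < k) ((-1) ^+ i * W i ord0) *:
     contractions (fun j => W' (lift i j)) (enum 'I_k.-1) q,
   (-1) ^+ k *: contractions W' (enum 'I_k) q).
Proof.
elim: k W p q => [|k IHk] W p q W'.
  by rewrite !contractions_enum0 big_ord0 addr0 scale1r.
rewrite !contractions_enumS /= IHk; congr pair; last first.
  by rewrite (linearN (contractions _ _)) scalerN exprS mulN1r scaleNr.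
rewrite (linearD (contractions _ _)) (linearZ_LR (contractions _ _)) /=.
(* The term split off is the one where row 0 itself removes e_0. *)
rewrite -addrA big_ord_recl expr0 mul1r; congr (_ + (_ + _)).
apply: eq_bigr => i _.
rewrite (linearN (contractions _ _)) scalerN -scaleNr exprS !mulN1r mulNr.
(* Deleting row i + 1 leaves row 0 in front, so the remaining family still starts with a contraction
   by row 0. *)
congr (_ *: _); case: k W @W' i {IHk} => [|k] W W' i; first by case: i.
rewrite contractions_enumS /=; congr contractions.
  apply/funext=> j; apply/funext=> l; rewrite /W'; congr (W _ _).
  by apply: val_inj; rewrite /= /bump !leq0n !add1n ltnS addnS.
apply: (congr1 (fun w : 'I_n -> A => contract w q)); apply/funext=> l.
by rewrite /W'; congr (W _ _); apply: val_inj; rewrite /= /bump.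
Qed.

(** Each contraction lowers the degree by one, and degrees do not exceed n. *)
Lemma contractions_overflow n (W : 'I_n.+1 -> 'I_n -> A) (f : exterior n) :
  contractions W (enum 'I_n.+1) f = 0.
Proof.
elim: n W f => [|n IHn] W f; rewrite contractions_enumS.
  by rewrite contractions_enum0.
rewrite -contractions_enumS; case: f => p q; rewrite contractions_pair.
rewrite contractions_enumS !IHn add0r big1 => [|i _]; last first.
  by rewrite IHn scaler0.
by rewrite contractions_enumS IHn scaler0.
Qed.

(** In [contractions_pair], the terms where all rows contract p, or all contract q, vanish by
    overflow; the rest is the expansion of the determinant along column 0. *)
Lemma contractions_all n (W : 'M[A]_n) (f : exterior n) :
  contractions (fun i j => W i j) (enum 'I_n) f = \det W *: of_low n (high f).
Proof.
elim: n W f => [|n IHn] W f; first by rewrite contractions_enum0 det_mx00 scale1r.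
case: f => p q; rewrite contractions_pair !contractions_overflow scaler0 add0r /=.
rewrite (expand_det_col _ ord0); congr pair; last by rewrite scaler0.
rewrite scaler_suml; apply: eq_bigr => i _.
rewrite /cofactor addn0 mulrCA mulrA -[RHS]scalerA; congr (_ *: _).
rewrite -/exterior in q *; rewrite -IHn; congr (contractions _ _ q).
by apply/funext=> j; apply/funext=> l; rewrite !mxE.
Qed.
End Exterior.

Lemma linear_comb (A : pzRingType) (V W : lmodType A) (f : {linear V -> W}) k
    (c : 'I_k -> A) (h : 'I_k -> V) :
  f (\sum_i c i *: h i) = \sum_i c i *: f (h i).
Proof. by rewrite linear_sum; apply: eq_bigr => i _; rewrite linearZ. Qed.

(** The exterior module is a finite direct sum of copies of M. *)
Lemma independent_exterior (A : comPzRingType) (M : lmodType A) k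
    (x : 'I_k -> A) n :
  independent M x -> independent (exterior M n) x.
Proof. by move=> indM; elim: n => //= n IHn; exact: independent_pair. Qed.

Lemma wedge_of_low_mem (A : comPzRingType) (M : lmodType A) (I : set A) n
    (u : 'I_n -> A) (m : M) :
  (forall j, ideal_smul M I (u j *: m)) ->
  ideal_smul (exterior M n) I (wedge u (of_low n m)).
Proof.
elim: n u => [|n IHn] u Ium /=; first exact: ideal_smul0.
apply: ideal_smul_pair; first exact: IHn.
rewrite linear0 subr0 -(linearZ_LR (@of_low A M n)).
apply: ideal_smul_linear (Ium ord0); exact: of_low_is_linear.
Qed.

Lemma high_wedge_mem (A : comPzRingType) (M : lmodType A) (I : set A) n
    (u : 'I_n -> A) (f : exterior M n) :
  (forall j, I (u j)) -> ideal_smul M I (high (wedge u f)).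
Proof.
elim: n u f => [|n IHn] u f Iu /=; first exact: ideal_smul0.
rewrite (linearB (@high A M n)) (linearZ_LR (@high A M n)) /=.
by apply: ideal_smulB; [exact: mem_ideal_smul|exact: IHn].
Qed.

(** * Contractions modulo J_x *)

Section Transition.
Variables (A : comPzRingType) (M : lmodType A) (k n : nat).
Variables (x : 'I_k -> A) (u : 'I_n -> A) (W : 'I_k -> 'I_n -> A).
Hypothesis x_indep : independent M x.
Hypothesis x_def : forall i, x i = \sum_j W i j * u j.
Let J := ideal_gen x.
Let L := exterior M n.

Lemma contractions_rcons s j (f : L) :
  contractions W (rcons s j) f = contract (W j) (contractions W s f).
Proof. by rewrite /contractions foldl_rcons. Qed.

Lemma contract_wedgeE i (f : L) :
  contract (W i) (wedge u f) = x i *: f - wedge u (contract (W i) f).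
Proof. by rewrite x_def -contract_wedge addrK. Qed.

(** Commuting one more contraction past the wedge flips the sign and creates a new error term, in
    the coefficient of x_j alone. *)
Lemma contractions_rcons_wedge s j (f : L) c (S : 'I_k -> L) :
  contractions W s (wedge u f) =
    c *: wedge u (contractions W s f) + \sum_i x i *: S i ->
  contractions W (rcons s j) (wedge u f) =
    - c *: wedge u (contractions W (rcons s j) f) +
    \sum_i x i *: (contract (W j) (S i)
                   + (i == j)%:R *: (c *: contractions W s f)).
Proof.
move=> Es; rewrite !contractions_rcons {}Es; set T := contractions W s f.
have -> : \sum_i x i *: (contract (W j) (S i) + (i == j)%:R *: (c *: T)) =
    \sum_i x i *: contract (W j) (S i) + x j *: (c *: T).
  under eq_bigr do rewrite scalerDr.
  rewrite big_split /=; congr (_ + _); rewrite (bigD1 j) //= eqxx scale1r.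
  by rewrite big1 ?addr0 // => i /negPf->; rewrite scale0r scaler0.
rewrite (linearD (contract _)) (linearZ_LR (contract _)) (linear_comb (contract _)) /=.
rewrite contract_wedgeE scalerBr !scalerA (mulrC (x j)) scaleNr.
by rewrite -addrA addrC -addrA; congr (_ + _); rewrite addrC.
Qed.

Lemma contractions_wedge s (f : L) :
  exists2 S : 'I_k -> L, forall i, i \notin s -> S i = 0
  & contractions W s (wedge u f) =
      (-1) ^+ size s *: wedge u (contractions W s f) + \sum_i x i *: S i.
Proof.
elim/last_ind: s => [|s j [S S0 /(contractions_rcons_wedge j) IHs]].
  exists (fun=> 0) => //=; rewrite scale1r big1 ?addr0 // => i _.
  by rewrite scaler0.
rewrite size_rcons exprS mulN1r; eexists; last exact: IHs.
move=> i; rewrite mem_rcons inE negb_or => /andP[/negPf-> /S0->].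
by rewrite linear0 scale0r addr0.
Qed.

(** As j is new, the earlier error terms do not involve x_j, so its coefficient is known exactly.
    Independence is applied to this coefficient below. *)
Lemma contractions_wedge_last s j (f : L) : j \notin s ->
  exists2 S : 'I_k -> L, S j = (-1) ^+ size s *: contractions W s f
  & contractions W (rcons s j) (wedge u f) =
      - (-1) ^+ size s *: wedge u (contractions W (rcons s j) f)
      + \sum_i x i *: S i.
Proof.
move=> js; have [S S0 /(contractions_rcons_wedge j) Es] := contractions_wedge s f.
eexists; last exact: Es.
by rewrite /= S0 // linear0 add0r eqxx scale1r.
Qed.

Lemma wedge_mem_preimage s (g e : L) : uniq s -> wedge u g = 0 ->
  ideal_smul L J (contractions W s g - wedge u e) ->
  exists e', ideal_smul L J (g - wedge u e').
Proof.
move=> + g0; elim/last_ind: s e => [|s j IHs] e; first by exists e.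
rewrite rcons_uniq => /andP[js s_uniq] /ideal_smul_genP[h /eqP].
rewrite subr_eq => /eqP Eh.
have [S Sj] := contractions_wedge_last g js.
rewrite g0 linear0 Eh (linearD (wedge u)) /= wedge_wedge addr0.
rewrite (linear_comb (wedge u)) scaler_sumr -big_split /= => S0.
(* Both expressions come from contracting [wedge u g] = 0; the coefficient of x_j says that, up to
   sign, [contractions W s g - wedge u (h j)] lies in J L. So [h j] is the next witness. *)
have /(_ _ j) := independent_exterior (n := n) x_indep (m := fun i =>
  - (-1) ^+ size s *: wedge u (h i) + S i) _.
rewrite Sj scaleNr addrC -scalerBr => Jj.
apply: (IHs (h j)) => //; rewrite -[X in ideal_smul _ _ X]scale1r.
rewrite -(signrMK (size s) 1) mulr1 -scalerA.
apply: ideal_smulZ; apply: Jj; rewrite [RHS]S0; apply: eq_bigr => i _.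
by rewrite scalerDr !scalerA mulrC.
Qed.

Lemma low_contractions_lift s (f : L) : uniq s ->
  ideal_smul L J (wedge u f) ->
  exists g e, ideal_smul L J (wedge u g) /\
    ideal_smul M J (low f - (-1) ^+ e *: low (contractions W s g)).
Proof.
move=> + Jf; elim/last_ind: s => [|s j IHs].
  by exists f, 0; split=> //; rewrite scale1r subrr; exact: ideal_smul0.
rewrite rcons_uniq => /andP[js /IHs[g [e [/ideal_smul_genP[h Eh] Jg]]]].
(* The relation sum_i x_i (u /\ h_i) = u /\ u /\ g = 0 puts u /\ h_j in J L. *)
exists (h j), (size s + e)%N; split.
  apply: (independent_exterior (n := n) x_indep (m := fun i => wedge u (h i))).
  by rewrite -(linear_comb (wedge u)) -Eh /= wedge_wedge.
have [S Sj] := contractions_wedge_last g js.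
rewrite Eh => /(congr1 (@low A M n)).
rewrite (linear_comb (contractions W _)) (linear_comb (@low A M n)).
rewrite (linearD (@low A M n)) (linearZ_LR (@low A M n)) /= low_wedge scaler0 add0r.
rewrite (linear_comb (@low A M n)) => E.
(* In degree 0 the wedge term disappears, so the two expansions of the contracted [wedge u g] can be
   compared at x_j. *)
have /(_ _ j) := x_indep (m := fun i =>
  low (contractions W (rcons s j) (h i)) - low (S i)) _.
rewrite Sj (linearZ_LR (@low A M n)) /= => Jj.
set T := low (contractions W s g) in Jg Jj.
set T' := low (contractions W _ _) in Jj *.
have -> : low f - (-1) ^+ (size s + e) *: T' =
    (low f - (-1) ^+ e *: T)
    - (-1) ^+ (size s + e) *: (T' - (-1) ^+ size s *: T).
  rewrite scalerBr scalerA exprD mulrAC -expr2 sqrr_sign mul1r.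
  by rewrite opprB addrA subrK.
apply: ideal_smulB => //; apply: ideal_smulZ; apply: Jj.
under eq_bigr do rewrite scalerBr.
by rewrite sumrB E subrr.
Qed.
End Transition.

(** * The colon submodules *)

Section Independent.
Variables (A : comPzRingType) (M : lmodType A) (n : nat).
Variables (x u : 'I_n -> A) (w : 'M[A]_n).
Hypothesis x_indep : independent M x.
Hypothesis x_def : forall i, x i = \sum_j w i j * u j.
Let Jx := ideal_gen x.
Let Ju := ideal_gen u.

Lemma ideal_gen_sub : Jx `<=` Ju.
Proof.
move=> a /ideal_genP[c ->]; apply/ideal_genP.
exists (fun j => \sum_i c i * w i j).
under eq_bigr => i _ do rewrite x_def mulr_sumr.
rewrite exchange_big; apply: eq_bigr => j _; rewrite mulr_suml.
by apply: eq_bigr => i _; rewrite mulrA.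
Qed.

Lemma ideal_smul_gen_sub m : ideal_smul M Jx m -> ideal_smul M Ju m.
Proof.
move: m; apply: ideal_smul_sub => [|a m /ideal_gen_sub]; last exact: mem_ideal_smul.
exact: ideal_smul_submodule.
Qed.

Lemma adj_mul_gen j : \sum_i (\adj w) j i * x i = \det w * u j.
Proof.
have /matrixP/(_ j 0) : \adj w *m \col_i x i = \det w *: \col_i u i.
  rewrite -mul_scalar_mx -mul_adj_mx -mulmxA; congr (_ *m _).
  apply/colP=> i; rewrite !mxE x_def; apply: eq_bigr => l _.
  by rewrite mxE.
by rewrite !mxE => <-; apply: eq_bigr => i _; rewrite [(\col_i x i) _ _]mxE.
Qed.

Lemma det_mul_gen (m : M) j : ideal_smul M Jx ((\det w * u j) *: m).
Proof.
apply: mem_ideal_smul; apply/ideal_genP.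
by exists (fun i => (\adj w) j i); rewrite adj_mul_gen.
Qed.

Lemma det_colon_gen (m : M) :
  ideal_smul M Jx (\det w *: m) -> ideal_smul M Ju m.
Proof.
move=> Jm.
(* The top form with coefficient m is killed by [wedge u], and its full contraction, Delta m in
   degree 0, already lies in J_x L; hence the starting value 0 for [e]. *)
have [|e /(ideal_smul_linear (@high_is_linear A M n))] :=
    wedge_mem_preimage x_indep x_def (enum_uniq 'I_n)
      (wedge_of_high u m) (e := 0).
  rewrite linear0 subr0 contractions_all high_of_high -linearZ /=.
  exact: ideal_smul_linear (@of_low_is_linear A M n) Jm.
rewrite linearB /= high_of_high => /ideal_smul_gen_sub Jme.
rewrite -(subrK (high (wedge u e)) m); apply: ideal_smulD => //.
by apply: high_wedge_mem => j; exact: mem_ideal_gen.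
Qed.

Lemma colon_gen_det (m : M) : (forall j, ideal_smul M Jx (u j *: m)) ->
  exists m', ideal_smul M Jx (m - \det w *: m').
Proof.
move=> /wedge_of_low_mem Jm.
have [g [e [_]]] := low_contractions_lift x_indep x_def (enum_uniq 'I_n) Jm.
rewrite contractions_all (linearZ_LR (@low A M n)) /= !low_of_low => Jmg.
by exists ((-1) ^+ e *: high g); rewrite scalerA mulrC -scalerA.
Qed.

Lemma independent_transition : independent M u.
Proof.
move=> m m0 j; apply: det_colon_gen.
(* Cramer's rule gives sum_i x_i D_i = Delta sum_l u_l m_l = 0, so each D_i is in J_x M; applying
   [w] to D then recovers Delta m_j. *)
pose D i := \sum_l (\adj w) l i *: m l.
have JD : forall i, ideal_smul M Jx (D i).
  apply: (x_indep (m := D)).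
  under eq_bigr => l _ do rewrite scaler_sumr.
  rewrite exchange_big /=; transitivity (\det w *: \sum_l u l *: m l); last first.
    by rewrite m0 scaler0.
  rewrite scaler_sumr.
  apply: eq_bigr => l _; rewrite scalerA -adj_mul_gen scaler_suml.
  by apply: eq_bigr => i _; rewrite scalerA mulrC.
suff -> : \det w *: m j = \sum_i w i j *: D i.
  by apply: ideal_smul_sum => l; exact: ideal_smulZ.
under eq_bigr => i _ do rewrite scaler_sumr.
rewrite exchange_big /= (bigD1 j) //= [X in _ + X]big1 => [|l lj].
  rewrite addr0; under eq_bigr => i _ do rewrite scalerA mulrC.
  have /matrixP/(_ j j) := mul_adj_mx w.
  by rewrite !mxE eqxx mulr1n => <-; rewrite scaler_suml.
under eq_bigr => i _ do rewrite scalerA mulrC.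
have /matrixP/(_ l j) := mul_adj_mx w.
by rewrite !mxE (negPf lj) mulr0n -scaler_suml => ->; rewrite scale0r.
Qed.
End Independent.

(** * Principal ideals and the three conclusions *)

Lemma principalP (A : comPzRingType) (d a : A) :
  principal d a <-> exists c, a = c * d.
Proof.
split=> [|[c ->]]; last first.
  have [_ _] := @gen_submodule_submodule A A^o [set d]; apply.
  exact: sub_gen_smallest.
move: a; apply: smallest_sub => [|_ ->]; last by exists 1; rewrite mul1r.
split=> [|_ _ [b ->] [c ->]|a _ [c ->]].
- by exists 0; rewrite mul0r.
- by exists (b + c); rewrite mulrDl.
- by exists (a * c); rewrite -mulrA.
Qed.

Theorem theorem1p1 (A : comPzRingType) (M : lmodType A) (n : nat)
    (x u : 'I_n -> A) (w : 'M[A]_n)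
    (x_indep : independent M x)
    (x_def : forall i, x i = \sum_(j < n) w i j * u j) :
  let Jx := ideal_gen x in
  let Ju := ideal_gen u in
  let Delta := \det w in
  let JxDelta := ideal_add Jx (principal Delta) in
  [/\ independent M u,
      colon (ideal_smul M Jx) Ju = ideal_smul M JxDelta /\
      colon (ideal_smul M Jx) JxDelta = ideal_smul M Ju
    & (exists m : M, m <> 0) -> finite_type M ->
      Ju `<=` jacobson_radical A -> ~ Jx Delta].
Proof.
move=> Jx Ju Delta JxDelta.
have JxS : Jx `<=` JxDelta.
  move=> a Ja; exists a, 0; split=> //; last by rewrite addr0.
  by apply/principalP; exists 0; rewrite mul0r.
have JDelta : JxDelta Delta.
  exists 0, Delta; split; last by rewrite add0r.
    by case: (@gen_submodule_submodule A A^o (range x)).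
  by apply/principalP; exists 1; rewrite mul1r.
have colon2 : colon (ideal_smul M Jx) JxDelta = ideal_smul M Ju.
  apply/seteqP; split=> [m /(_ _ JDelta)|m].
    exact: det_colon_gen.
  move=> Jm a [b [_ [Jb /principalP[c ->] ->]]].
  rewrite scalerDl; apply: ideal_smulD; first exact: mem_ideal_smul.
  rewrite -scalerA; apply: ideal_smulZ.
  have /ideal_smul_genP[h ->] := Jm; rewrite scaler_sumr.
  by apply: ideal_smul_sum => j; rewrite scalerA; exact: det_mul_gen.
split; first exact: independent_transition x_def.
- split=> //; apply/seteqP; split=> [m Jm|].
    have [|m' Jm'] := @colon_gen_det _ M _ _ _ _ x_indep x_def m.
      by move=> j; apply: Jm; exact: mem_ideal_gen.
    rewrite -(subrK (Delta *: m') m); apply: ideal_smulD.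
      move: Jm'; apply: ideal_smul_sub; first exact: ideal_smul_submodule.
      by move=> a v /JxS; exact: mem_ideal_smul.
    exact: mem_ideal_smul.
  apply: ideal_smul_sub => [|a m [b [_ [Jb /principalP[c ->] ->]]] d Jd].
    split=> [|m1 m2 J1 J2|b m Jm] a Ja.
    - by rewrite scaler0; exact: ideal_smul0.
    - by rewrite scalerDr; apply: ideal_smulD; [exact: J1|exact: J2].
    - by rewrite scalerA mulrC -scalerA; apply: ideal_smulZ; exact: Jm.
  rewrite scalerDl scalerDr; apply: ideal_smulD.
    by apply: ideal_smulZ; exact: mem_ideal_smul.
  have /ideal_genP[f ->] := Jd.
  rewrite scaler_suml; apply: ideal_smul_sum => j.
  rewrite scalerA mulrACA (mulrC (u j)) -scalerA.
  by apply: ideal_smulZ; exact: det_mul_gen.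
- move=> [m m0] ftM radJ JxD; apply: m0.
  apply: (nakayama (I := Ju)) => //; first exact: gen_submodule_submodule.
  (* If Delta is in J_x, then J_x + (Delta) multiplies all of M into J_x M, so the second colon
     equality reads J_u M = M. *)
  rewrite -colon2; apply/seteqP; split=> // v _ a [b [_ [Jb /principalP[c ->] ->]]].
  rewrite scalerDl -scalerA; apply: ideal_smulD; first exact: mem_ideal_smul.
  by apply: ideal_smulZ; exact: mem_ideal_smul.
Qed.
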